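(* Let $G=(V,E)$ be a forest with $n\geq 2$ vertices. Let $\sigma\in\Lambda_G$ be a labeling of $G$, and let $t$ be the number of vertices in the connected component of $G$ containing the vertex $\sigma^{-1}(1)$. Then the size of the orbit of $\sigma$ under toric promotion $\mathrm{TPro}\colon\Lambda_G\to\Lambda_G$ is $$(n-1)\frac{t}{\gcd(t,n)}.$$ In particular, if $G$ is a tree, then every orbit of $\mathrm{TPro}\colon\Lambda_G\to\Lambda_G$ has size $n-1$.
   Context: All graphs are finite and simple. Let $G=(V,E)$ be a graph with $n$ vertices and $[n]=\{1,\ldots,n\}$. A labeling of $G$ is a bijection $V\to[n]$; $\Lambda_G$ is the set of all labelings of $G$. For distinct $i,j\in[n]$, let $(i\;j)\in S_n$ be the transposition swapping $i$ and $j$. The toggle operator $\tau_{i,j}\colon\Lambda_G\to\Lambda_G$ is defined by $\tau_{i,j}(\sigma)=(i\;j)\circ\sigma$ if $\{\sigma^{-1}(i),\sigma^{-1}(j)\}\notin E$, and $\tau_{i,j}(\sigma)=\sigma$ if $\{\sigma^{-1}(i),\sigma^{-1}(j)\}\in E$. Write $\tau_i=\tau_{i,i+1}$ for $i\in[n-1]$ and $\tau_n=\tau_{n,1}$. Toric promotion is the operator $\mathrm{TPro}=\tau_n\tau_{n-1}\cdots\tau_2\tau_1\colon\Lambda_G\to\Lambda_G$ (composition of maps, with $\tau_1$ applied first). It is a bijection since each toggle is an involution. The orbit of $\sigma$ is $\{\mathrm{TPro}^k(\sigma):k\ge 0\}$. *)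

(* Defs.v *)
From HB Require Import structures.
From mathcomp Require Import all_boot perm.

Set Implicit Arguments.
Unset Strict Implicit.
Unset Printing Implicit Defensive.

(* A graph on V is a relation e : rel V, assumed symmetric and irreflexive.   *)
(* The label set {1, ..., n} is represented by 'I_n: the ordinal i stands for *)
(* the label i.+1, so the label 1 is the ordinal 0.                           *)

(* A cycle has at least 3 vertices, all distinct; ucycle alone also holds for *)
(* the empty sequence and for both ends of an edge.                           *)
Definition is_forest (V : finType) (e : rel V) : Prop :=
  forall c : seq V, 2 < size c -> ~ ucycle e c.

Definition is_tree (V : finType) (e : rel V) : Prop :=
  [/\ 0 < #|V|, is_forest e & forall x y : V, connect e x y].

Definition component (V : finType) (e : rel V) (x : V) : {set V} :=
  [set y | connect e x y].

Definition bijectiveb (V : finType) (n : nat) (f : {ffun V -> 'I_n}) : bool :=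
  injectiveb f && [forall i, i \in codom f].

Record labeling (V : finType) (n : nat) := Labeling {
  labeling_fun :> {ffun V -> 'I_n};
  labeling_bij : bijectiveb labeling_fun
}.

HB.instance Definition _ (V : finType) (n : nat) :=
  [isSub for @labeling_fun V n].
HB.instance Definition _ (V : finType) (n : nat) :=
  [Countable of labeling V n by <:].
HB.instance Definition _ (V : finType) (n : nat) :=
  [Finite of labeling V n by <:].

Lemma labeling_surj (V : finType) (n : nat) (sigma : labeling V n) (i : 'I_n) :
  i \in codom sigma.
Proof. by case/andP: (labeling_bij sigma) => _ /forallP. Qed.

Definition labeling_inv (V : finType) (n : nat) (sigma : labeling V n)
    (i : 'I_n) : V :=
  iinv (labeling_surj sigma i).

Definition swap_fun (V : finType) (n : nat) (i j : 'I_n) (sigma : labeling V n)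
    : {ffun V -> 'I_n} :=
  [ffun v => tperm i j (sigma v)].

Lemma swap_bij (V : finType) (n : nat) (i j : 'I_n) (sigma : labeling V n) :
  bijectiveb (swap_fun i j sigma).
Proof.
case/andP: (labeling_bij sigma) => /injectiveP sI _; apply/andP; split.
  by apply/injectiveP => u v; rewrite !ffunE => /perm_inj /sI.
apply/forallP => k; apply/codomP; exists (labeling_inv sigma (tperm i j k)).
by rewrite ffunE /labeling_inv f_iinv tpermK.
Qed.

Definition swap_labels (V : finType) (n : nat) (i j : 'I_n)
    (sigma : labeling V n) : labeling V n :=
  Labeling (swap_bij i j sigma).

Definition toggle (V : finType) (n : nat) (e : rel V) (i j : 'I_n)
    (sigma : labeling V n) : labeling V n :=
  if e (labeling_inv sigma i) (labeling_inv sigma j) then sigma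
  else swap_labels i j sigma.

(* ordS is the cyclic successor on 'I_n, so the last toggle swaps the labels  *)
(* n and 1; foldl along the increasing enumeration applies tau_1 first.       *)
Definition TPro (V : finType) (n : nat) (e : rel V) (sigma : labeling V n) :
    labeling V n :=
  foldl (fun s i => toggle e i (ordS i) s) sigma (enum 'I_n).

(* Main.v *)
(* Put a stone on the vertex about to be toggled: just before the toggle
   [tau_i] it is on the vertex labelled [i], and the other [n - 1] vertices sit,
   in the cyclic order of their labels, on [n - 1] positions that do not move.
   A toggle reads the next position; if its occupant is adjacent to the stone,
   the stone jumps to it and leaves its former vertex behind in that position.
   Root the component of [sigma^-1(1)] at that vertex.  In a forest the edge
   from [x] to its parent is only ever crossed at the initial position of [x],
   so the whole state is a function of the vertex under the stone, and a round
   of [n - 1] toggles moves the stone by a product of the transpositions of all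
   the edges of the component, which is a [t]-cycle.  As [TPro] consists of [n]
   toggles, [TPro^k] fixes [sigma] iff [n - 1] divides [k] (the positions line
   up again) and [t] divides [k * n / (n - 1)] (the stone is back). *)

Require Import Defs.
From mathcomp Require Import fingroup perm.
From mathcomp Require Import all_boot zify.

Set Implicit Arguments.
Unset Strict Implicit.
Unset Printing Implicit Defensive.

(** * Unique paths in a forest and rooting of a component *)

Section Forest.

Variables (V : finType) (e : rel V).
Hypotheses (e_sym : symmetric e) (e_irr : irreflexive e).
Hypothesis e_forest : is_forest e.

(** Where the paths first part, through [a] and [b], their tails join [a] to [b] while avoiding [x];
    together with [x] this closes a cycle. *)
Lemma forest_path_unique x p q :
  path e x p -> uniq (x :: p) -> path e x q -> uniq (x :: q) ->
  last x p = last x q -> p = q.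
Proof.
elim: p x q => [|a p IHp] x [|b q] //=.
- by move=> _ _ _ /andP[xq _] xE; rewrite xE mem_last in xq.
- by move=> _ /andP[xp _] _ _ xE; rewrite -xE mem_last in xp.
case/andP=> xa pp /andP[xp up] /andP[xb pq] /andP[xq uq] lpq.
have [ab|aNb] := eqVneq a b.
  by rewrite -ab in pq uq lpq *; rewrite (IHp a q).
pose e' := [rel u w | [&& e u w, u != x & w != x]].
have e'_sym : symmetric e'.
  by move=> u w /=; rewrite e_sym; congr (_ && _); rewrite andbC.
have sub_e' c r : path e c r -> x \notin c :: r -> path e' c r.
  elim: r c => //= d r IHr c /andP[cd dr].
  rewrite !inE !negb_or => /and3P[xc xd xr].
  by rewrite cd eq_sym xc eq_sym xd IHr // inE negb_or xd.
have : connect e' a b.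
  apply: (@connect_trans _ _ (last a p)).
    by apply/connectP; exists p => //; apply: sub_e'.
  rewrite (sym_connect_sym e'_sym) lpq.
  by apply/connectP; exists q => //; apply: sub_e'.
case/connectP => r0 r0P bE; move: bE; case/shortenP: r0P => r rP ur _ bE.
have xr : x \notin a :: r.
  rewrite inE negb_or; apply/andP; split.
    by apply: contraNneq xp => ->; rewrite mem_head.
  elim: r a rP {ur bE r0 aNb xa pp xp up lpq IHp} => //= d r IHr a.
  case/andP=> /and3P[_ _ dx] rP.
  by rewrite inE negb_or eq_sym dx (IHr d).
have er : path e a r by apply: sub_path rP => u w /and3P[].
(* [a != b] makes [r] nonempty, so the cycle has at least 3 vertices. *)
case: (e_forest (c := [:: x, a & r])).
  by case: r bE {rP ur xr er} => [|//] /= bE; rewrite bE eqxx in aNb.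
apply/andP; split; last by rewrite [uniq _]/= xr.
by rewrite /= rcons_path xa er /= -bE e_sym.
Qed.

(** [par] fixes the root and everything outside the component, so [tperm x (par x)] is trivial
    there. *)
Record rooted_at (v : V) (par : V -> V) (depth : V -> nat) : Prop := RootedAt {
  par_edge : forall x, connect e v x -> x != v -> e x (par x);
  par_component : forall x, par x != x -> connect e v x && (x != v);
  par_depth : forall x, par x != x -> depth (par x) < depth x;
  edge_par : forall x y, connect e v x -> e x y -> par x = y \/ par y = x
}.

Lemma forest_rooted_at v : exists par depth, rooted_at v par depth.
Proof.
have /fin_all_exists[P PP] x : exists p, if connect e v x
    then [/\ path e x p, uniq (x :: p) & last x p = v] else p = [::].
  case: (boolP (connect e v x)) => [|_]; last by exists [::].
  rewrite (sym_connect_sym e_sym) => /connectP[p pP ->].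
  by case/shortenP: pP => q qP uq _; exists q.
have con x y : connect e v x -> e x y -> connect e v y.
  by move=> vx xy; apply: connect_trans vx (connect1 xy).
have PE x p : connect e v x -> path e x p -> uniq (x :: p) -> last x p = v ->
    P x = p.
  move=> vx pP up lp; have := PP x; rewrite vx => -[qP uq lq].
  by apply: forest_path_unique qP uq pP up _; rewrite lp.
(* [P x] is empty at the root and outside the component; the default of [head] then gives
   [par x = x]. *)
exists (fun x => head x (P x)), (fun x => size (P x)).
split=> [x vx|x|x|x y vx xy].
- have := PP x; rewrite vx; case: (P x) => [|a p] /= [].
    by move=> _ _ ->; rewrite eqxx.
  by case/andP.
- have := PP x; case: ifP => [vx|_ ->]; last by rewrite eqxx.
  case: (P x) => [|a p] [] /=; first by rewrite eqxx.
  move=> _ /andP[xp _] lp _; apply: contraNneq xp => ->.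
  by rewrite -lp mem_last.
- have := PP x; case: ifP => [vx|_ ->]; last by rewrite eqxx.
  case E: (P x) => [|a p] [] /=; first by rewrite eqxx.
  case/andP=> xa pP /andP[_ up] lp _.
  by rewrite (PE a p) // (con x).
have vy := con _ _ vx xy.
have := PP x; rewrite vx => -[pP up lp].
(* By uniqueness, [P x] starts with [y] if it meets [y]; otherwise [P y] is [x :: P x]. *)
have [yp|yp] := boolP (y \in P x); last first.
  right; rewrite (PE y (x :: P x)) //= ?pP ?[e y x]e_sym ?xy //.
  rewrite inE negb_or yp -andbA; apply/and3P; split=> //.
  by apply: contraTneq xy => ->; rewrite e_irr.
left; case/splitPr: yp (PE x) pP up lp => p1 p2 PEx.
rewrite cat_path last_cat /= => /and3P[_ _ p2P] /andP[xp].
rewrite cat_uniq => /and3P[_ _ /= up2] lp.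
rewrite (PEx (y :: p2)) //= ?xy ?up2 ?andbT //.
by apply: contra xp => xp; rewrite mem_cat xp orbT.
Qed.

End Forest.

(** * Sets stable under products of transpositions *)

Section TpermProducts.

Variables (V : finType) (par : V -> V).

(** Serves for the descendants of a vertex, the component, and a single vertex outside it. *)
Lemma prod_tperm_stable (P : pred V) (l : seq V) :
  {in l, forall x, P (par x) = P x} ->
  forall y, P ((\prod_(x <- l) tperm x (par x))%g y) = P y.
Proof.
elim: l => [|x l IHl] Pl y; first by rewrite big_nil perm1.
rewrite big_cons permM IHl; last by move=> z zl; rewrite Pl // inE zl orbT.
by have := Pl x (mem_head _ _); case: tpermP => [->|->|].
Qed.

Lemma porbit_stable (P : pred V) (s : {perm V}) x y :
  (forall z, P (s z) = P z) -> y \in porbit s x -> P y = P x.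
Proof.
move=> Ps /porbitP[i ->]; elim: i => [|i IHi]; first by rewrite perm1.
by rewrite expgSr permM Ps.
Qed.

Lemma card_porbits1 : #|porbits (1%g : {perm V})| = #|V|.
Proof.
rewrite /porbits card_imset // => x y; have := porbit_id 1%g x.
by move=> + E; rewrite E => /porbitP[i]; rewrite expg1n perm1.
Qed.

End TpermProducts.

(** * The cycle formed by the edges of a rooted component, and the moves of the stone *)

Section Rooted.

Variables (V : finType) (e : rel V) (v : V) (par : V -> V) (depth : V -> nat).
Hypotheses (e_sym : symmetric e) (e_irr : irreflexive e).
Hypothesis rooted : rooted_at e v par depth.

Lemma par_root : par v = v.
Proof.
by apply/eqP/negPn/negP => /(par_component rooted); rewrite eqxx andbF.
Qed.

Lemma par_neq x : (par x != x) = connect e v x && (x != v).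
Proof.
apply/idP/idP; first exact: (par_component rooted).
case/andP=> vx xNv; have := par_edge rooted vx xNv.
by apply: contraTneq => ->; rewrite e_irr.
Qed.

Lemma connect_par x : connect e v (par x) = connect e v x.
Proof.
have [->//|] := eqVneq (par x) x; rewrite par_neq => /andP[vx xNv].
by rewrite vx (connect_trans vx) // connect1 // (par_edge rooted).
Qed.

(** [fconnect par y x] reads: [x] is [y] or an ancestor of [y]. *)
Lemma ancestor_depth x y : fconnect par y x -> (x == y) || (depth x < depth y).
Proof.
move=> /iter_findex <-; elim: (findex _ _ _) => [|i IHi]; first by rewrite eqxx.
rewrite iterS; set w := iter i par y in IHi *.
have [->//|/(par_depth rooted) pw] := eqVneq (par w) w; apply/orP; right.
by case/orP: IHi => [/eqP <-|] //; apply: ltn_trans.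
Qed.

Lemma ancestor_par x y : x != y -> fconnect par (par y) x = fconnect par y x.
Proof.
move=> xy; apply/idP/idP.
  by apply: connect_trans; apply: fconnect1.
move=> /iter_findex; case: (findex _ _ _) => [E|i <-].
  by rewrite -E eqxx in xy.
by rewrite iterSr fconnect_iter.
Qed.

Lemma ancestor_parF x : par x != x -> fconnect par (par x) x = false.
Proof.
move=> px; apply/negP => /ancestor_depth; rewrite eq_sym (negPf px) /=.
by have := par_depth rooted px; lia.
Qed.

(* Each new factor joins two cycles: the descendants of [x] are stable under
   the transpositions of all the other edges, and [par x] is not one of them. *)
Lemma card_porbits_prod (l : seq V) : uniq l ->
  #|porbits (\prod_(x <- l) tperm x (par x))%g|
    + count (fun x => par x != x) l = #|V|.
Proof.
elim: l => [_|x l IHl /andP[xl ul]].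
  by rewrite big_nil addn0 card_porbits1.
rewrite big_cons /= -(IHl ul); set s := (\prod_(z <- l) _)%g.
have [pE|px] := eqVneq (par x) x; first by rewrite pE tperm1 mul1g.
have := porbits_mul_tperm s x (par x); rewrite eq_sym px.
suff -> : x \notin porbit s (par x) by rewrite /=; lia.
rewrite porbit_sym; apply/negP.
move/(porbit_stable (P := fun y => fconnect par y x)).
rewrite ancestor_parF // connect0.
suff sD z : fconnect par (s z) x = fconnect par z x by move/(_ sD).
apply: (prod_tperm_stable (P := fun y => fconnect par y x)) => w wl.
by apply: ancestor_par; apply: contraNneq xl => ->.
Qed.

(** With [t - 1] edges there are [#|V| - t + 1] cycles. The vertices outside the component are fixed
    points; if some [y] in it missed the cycle of [v], these with [v] and [y] would lie in
    [#|V| - t + 2] distinct cycles. *)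
Lemma card_porbit_prod (l : seq V) : uniq l -> l =i predC1 v ->
  #|porbit (\prod_(x <- l) tperm x (par x))%g v| = #|component e v|.
Proof.
move=> ul lv; set s := (\prod_(x <- l) _)%g; set C := component e v.
have vC : v \in C by rewrite inE.
have sC y z : z \in porbit s y -> (z \in C) = (y \in C).
  apply: (porbit_stable (P := fun w => w \in C)).
  apply: (prod_tperm_stable (P := fun w => w \in C)) => x _.
  by rewrite !inE connect_par.
have fix_s y z : y \notin C -> z \in porbit s y -> z = y.
  move=> yC /(porbit_stable (P := pred1 y)) /= H; apply/eqP; rewrite H ?eqxx //.
  apply: (prod_tperm_stable (P := pred1 y)) => x _ /=.
  have [->//|] := eqVneq (par x) x; rewrite par_neq => /andP[vx _].
  transitivity false.
    by apply: contraNF yC => /eqP <-; rewrite inE connect_par.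
  by apply/esym; apply: contraNF yC => /eqP <-; rewrite inE.
have card_s : #|porbits s| + #|C| = #|V|.+1.
  rewrite -(card_porbits_prod ul) -/s -size_filter (cardsD1 v) vC.
  suff -> : #|C :\ v| = size [seq x <- l | par x != x].
    by rewrite add1n addnS.
  rewrite -(card_uniqP (filter_uniq _ ul)); apply: eq_card => x.
  by rewrite mem_filter lv par_neq !inE; case: (x != v); rewrite ?andbT ?andbF.
apply: eq_card => y; apply/idP/idP => [/sC->//|yC].
apply: contraT => yv.
have yNv : y != v by apply: contraNneq yv => ->; apply: porbit_id.
have inj : {in [set v; y] :|: ~: C &, injective (porbit s)}.
  move=> a b; rewrite !inE => aS bS ab.
  have {}ab : a \in porbit s b by rewrite -ab porbit_id.
  have ba : b \in porbit s a by rewrite porbit_sym.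
  have [bC|/fix_s/(_ ab)//] := boolP (b \in C).
  have aC : a \in C by rewrite (sC b).
  move: aC bC aS bS; rewrite !inE => -> ->; rewrite !orbF.
  by move=> /orP[]/eqP aE /orP[]/eqP bE; move: ab ba;
    rewrite aE bE // (negPf yv).
have := card_in_imset inj.
have /subset_leq_card : porbit s @: ([set v; y] :|: ~: C) \subset porbits s.
  by apply/subsetP => _ /imsetP[z _ ->]; apply: imset_f.
rewrite cardsU disjoint_setI0 ?cards0; last first.
  by rewrite disjoints_subset setCK; apply/subsetP => z /set2P[]->.
by rewrite cards2 [v == y]eq_sym yNv; have := cardsC C; lia.
Qed.

(* [displace x y] is the vertex found at the initial position of [x] when the
   stone is at [y]: every vertex on the path from the root to [y] has been
   replaced by its parent. *)
Definition displace x y := if fconnect par y x then par x else x.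

Lemma displace_root x : x != v -> displace x v = x.
Proof.
move=> xv; rewrite /displace; case: ifP => // /iter_findex xE.
by case/eqP: xv; rewrite -xE; elim: (findex _ _ _) => //= i ->; apply: par_root.
Qed.

(** The edge crossed must join [x] and [par x]: down to up if [x] is [y] or an ancestor of [y], up
    to down otherwise. Crossing it changes the ancestors of the stone by [x] alone, so the other
    positions keep their occupants. *)
Lemma displace_move x y : connect e v y -> x != v -> e y (displace x y) ->
  [/\ tperm x (par x) y = displace x y, displace x (displace x y) = y
    & forall z, z != x -> displace z (displace x y) = displace z y].
Proof.
move=> vy xv; rewrite /displace; case: ifP => [xy yp|xy yx].
  have vx : connect e v x.
    move: vy; rewrite -(iter_findex xy); elim: (findex _ _ _) => //= i IHi vy.
    by rewrite connect_par IHi.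
  have px : par x != x by rewrite par_neq vx.
  have -> : y = x.
    case: (edge_par rooted vy yp) => [E|E].
      apply/eqP; apply: contraFT (ancestor_parF px).
      by rewrite -E => yNx; rewrite ancestor_par // eq_sym.
    have := ancestor_depth xy; have := par_depth rooted px.
    have [F|/(par_depth rooted)] := eqVneq (par (par x)) (par x).
      by move: yp; rewrite -E F e_irr.
    by rewrite E => ? ? /orP[/eqP->//|?]; lia.
  rewrite tpermL ancestor_parF //; split=> // z zx.
  by rewrite ancestor_par.
have yE : par x = y.
  case: (edge_par rooted vy yx) => // E.
  by rewrite -E fconnect1 in xy.
rewrite yE tpermR connect0; split=> // z zx.
by rewrite -yE ancestor_par.
Qed.

(** At either end of a genuine edge from [x] to [par x], the displaced vertex is the other end,
    hence adjacent to [y]. *)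
Lemma displace_stay x y : connect e v y -> x != v -> ~~ e y (displace x y) ->
  tperm x (par x) y = y.
Proof.
move=> vy xv; rewrite /displace; case: tpermP => [->|->|//].
  rewrite connect0; have [//|] := eqVneq (par x) x.
  rewrite par_neq => /andP[vx _].
  by rewrite (par_edge rooted).
have [//|px] := eqVneq (par x) x; rewrite ancestor_parF //.
by move: px; rewrite par_neq => /andP[vx _]; rewrite e_sym (par_edge rooted).
Qed.

End Rooted.

(** * Orbit sizes from periods *)

Lemma order_eq_dvdn (T : finType) (f : T -> T) x N : 0 < N ->
  (forall k, iter k f x = x <-> N %| k) -> order f x = N.
Proof.
case: N => // N _ fN; have fNx : iter N.+1 f x = x by apply/fN.
rewrite -(size_traject f x N.+1); apply: order_cycle; last exact: mem_head.
  by rewrite /= rcons_path fpath_traject /= last_traject -iterS fNx /=.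
rewrite looping_uniq; apply/negP => /trajectP[i iN iE].
(* If step [N] repeats step [i < N], one more step returns to [x] after only [i.+1] steps. *)
have /fN/dvdn_leq : iter (N.+1 - (N - i)) f x = x.
  have -> : N.+1 - (N - i) = i.+1 by lia.
  by rewrite iterS -iE -iterS.
by lia.
Qed.

Lemma iter_perm_eq (T : finType) (s : {perm T}) x k :
  iter k s x = x <-> #|porbit s x| %| k.
Proof.
have per q : iter (q * #|porbit s x|) s x = x.
  by elim: q => // q IHq; rewrite mulSn addnC iterD iter_porbit.
split=> [|/dvdnP[q ->]//].
rewrite {1}(divn_eq k #|porbit s x|) addnC iterD per => kE.
have N_gt0 : 0 < #|porbit s x| by apply/card_gt0P; exists x; apply: porbit_id.
have := uniq_traject_porbit s x; have := ltn_pmod k N_gt0.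
rewrite /dvdn; case: (#|_|) (k %% _) kE => // N [//|r] rE rN.
move/(uniqP x)/(_ 0 r.+1).
by rewrite !inE !size_traject !nth_traject // rE => /(_ isT rN erefl).
Qed.

(** * Toggles described through vertices *)

Section Labelings.

Variables (V : finType) (n : nat).
Implicit Types s : labeling V n.

Lemma labeling_inj s : injective s.
Proof. by case/andP: (labeling_bij s) => /injectiveP. Qed.

Lemma labeling_invK s i : s (labeling_inv s i) = i.
Proof. by rewrite /labeling_inv f_iinv. Qed.

Lemma labelingK s u : labeling_inv s (s u) = u.
Proof. by apply: (@labeling_inj s); rewrite labeling_invK. Qed.

Lemma toggle_edge (e : rel V) s y u : e y u -> toggle e (s y) (s u) s = s.
Proof. by rewrite /toggle !labelingK => ->. Qed.

Lemma toggle_nonedge (e : rel V) s y u w :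
  ~~ e y u -> toggle e (s y) (s u) s w = tperm (s y) (s u) (s w).
Proof. by rewrite /toggle !labelingK => /negPf->; rewrite ffunE. Qed.

End Labelings.

(** * The stone during toric promotion, with [n = m.+1] *)

Section Stone.

Variables (V : finType) (m : nat) (e : rel V).
Hypotheses (m_gt0 : 0 < m) (e_sym : symmetric e) (e_irr : irreflexive e).
Variables (s0 : labeling V m.+1) (par : V -> V) (depth : V -> nat).
Let v := labeling_inv s0 ord0.
Hypothesis rooted : rooted_at e v par depth.

(** The initial occupant of position [j], counted modulo [m]; the shift skips the ordinal label 0 of
    the root. *)
Definition home j := labeling_inv s0 (inord (j %% m).+1).

Lemma label_home j : s0 (home j) = (j %% m).+1 :> nat.
Proof. by rewrite labeling_invK inordK // ltnS ltn_pmod. Qed.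

Lemma home_neq_root j : home j != v.
Proof.
apply/eqP => /(congr1 (fun u => val (s0 u))) /=.
by rewrite label_home labeling_invK.
Qed.

Lemma homeK w : w != v ->
  [/\ (s0 w).-1 < m, home (s0 w).-1 = w & 0 < s0 w].
Proof.
move=> wv; have s0w : 0 < s0 w.
  rewrite lt0n; apply: contra_neq wv => w0; rewrite /v.
  by rewrite -(labelingK s0 w); congr labeling_inv; apply: val_inj.
have wm : (s0 w).-1 < m by have := ltn_ord (s0 w); lia.
split=> //; rewrite /home modn_small // prednK // -[RHS](labelingK s0).
by congr labeling_inv; apply: val_inj; rewrite /= inordK.
Qed.

(** Computed without the current labeling; [stone_state_toggle] shows that the toggles follow it. *)
Fixpoint stone T :=
  if T is T'.+1 then tperm (home T') (par (home T')) (stone T') else v.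

Lemma stone_component T : connect e v (stone T).
Proof.
elim: T => [|T IHT] /=; first exact: connect0.
case: tpermP => [E|E|//]; move: IHT; rewrite E (connect_par e_irr rooted) //.
Qed.

(* The state before the [T.+1]-st toggle: the stone carries the label [T],
   and reading on from it the other labels run through the [m] positions,
   starting at position [T]. *)
Definition stone_state T (s : labeling V m.+1) :=
  s (stone T) = T %% m.+1 :> nat /\
  forall j, j < m ->
    s (displace par (home (T + j)) (stone T)) = (T + j.+1) %% m.+1 :> nat.

Lemma home_mod i j : i = j %[mod m] -> home i = home j.
Proof. by rewrite /home => ->. Qed.

Lemma home_inj T i j : i < m -> j < m -> home (T + i) = home (T + j) -> i = j.
Proof.
move=> im jm /(congr1 (fun u => val (s0 u))) /=; rewrite !label_home => -[].
by move=> /eqP; rewrite eqn_modDl !modn_small // => /eqP.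
Qed.

(** The occupant [u] of position [T] has label [T.+1]. Along an edge the labels stay and the stone
    passes to [u]; otherwise the labels swap and the stone stays. Either way label [T] is left at
    position [T]. *)
Lemma stone_state_toggle T s (i : 'I_m.+1) : i = T %% m.+1 :> nat ->
  stone_state T s -> stone_state T.+1 (toggle e i (ordS i) s).
Proof.
move=> iT [sy sd]; set y := stone T in sy sd.
set x := home T; set u := displace par x y.
have su : s u = T.+1 %% m.+1 :> nat by rewrite -(addn1 T) -(sd 0) ?addn0.
have -> : i = s y by apply: val_inj; rewrite /= iT sy.
have -> : ordS (s y) = s u.
  by apply: val_inj; rewrite /= su sy -(addn1 (T %% _)) modnDml addn1.
have vy : connect e v y := stone_component T.
have xv : x != v := home_neq_root T.
(* The position just read is now the last in reading order. *)
have lastE j : j.+1 = m -> home (T.+1 + j) = x.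
  by move=> jm; apply: home_mod; rewrite addSnnS jm modnDr.
have lastL j : j.+1 = m -> T.+1 + j.+1 = T %[mod m.+1].
  by move=> jm; rewrite jm addSnnS modnDr.
have [yu|yu] := boolP (e y u).
  have [stE dE dN] := displace_move e_irr rooted vy xv yu.
  rewrite toggle_edge //; split=> [|j jm]; first by rewrite /= stE.
  rewrite [stone _]/= -/x -/y stE -/u.
  have [jE|jN] := eqVneq j.+1 m; first by rewrite lastE // dE lastL.
  have j1m : j.+1 < m by lia.
  rewrite addSnnS dN; first by rewrite sd // addSnnS.
  by apply/eqP; rewrite /x -[in RHS](addn0 T) => /home_inj-/(_ j1m m_gt0).
have stE : stone T.+1 = y := displace_stay e_sym e_irr rooted vy xv yu.
split=> [|j jm]; rewrite stE toggle_nonedge //; first by rewrite tpermL.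
have [jE|jN] := eqVneq j.+1 m; first by rewrite lastE // -/u tpermR sy lastL.
have j1m : j.+1 < m by lia.
have sw := sd _ j1m; rewrite addSnnS addSnnS.
rewrite tpermD ?sw //; apply/eqP => /(congr1 val) /= /eqP; rewrite sw ?sy ?su.
  by rewrite -[in X in X == _](addn0 T) eqn_modDl !modn_small; lia.
by rewrite -(addn1 T) eqn_modDl !modn_small; lia.
Qed.

Lemma stone_state_TPro k s :
  stone_state (k * m.+1) s -> stone_state (k.+1 * m.+1) (TPro e s).
Proof.
move=> st; rewrite /TPro.
suff H j : j <= m.+1 -> stone_state (k * m.+1 + j)
    (foldl (fun s i => toggle e i (ordS i) s) s (take j (enum 'I_m.+1))).
  have := H m.+1 (leqnn _); rewrite mulSn addnC take_oversize //.
  by rewrite size_enum_ord.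
elim: j => [|j IHj] jm; first by rewrite take0 addn0.
rewrite (take_nth ord0) ?size_enum_ord // foldl_rcons addnS.
apply: stone_state_toggle; last by apply: IHj; lia.
by rewrite nth_enum_ord // modnMDl modn_small.
Qed.

Lemma stone_state0 : stone_state 0 s0.
Proof.
split=> [|j jm]; first by rewrite labeling_invK.
rewrite (displace_root rooted) ?home_neq_root // label_home.
by rewrite !add0n !modn_small.
Qed.

Lemma iter_TPro_eq k :
  iter k (TPro e) s0 = s0 <-> m %| k /\ stone (k * m.+1) = v.
Proof.
have st : stone_state (k * m.+1) (iter k (TPro e) s0).
  elim: k => [|k IHk]; first exact: stone_state0.
  exact: stone_state_TPro.
case: st; set s := iter _ _ _; rewrite modnMl => sv sd; split.
  move=> sE; rewrite sE in sv sd.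
  have stE : stone (k * m.+1) = v.
    apply: (@labeling_inj _ _ s0); apply: val_inj.
    by rewrite /= sv labeling_invK.
  (* Label 1 now sits at position [k * m.+1], which is [k] modulo [m], and started at position 0. *)
  split=> //; have := sd 0 m_gt0; rewrite stE.
  rewrite (displace_root rooted) ?home_neq_root // label_home addn0.
  rewrite modnMDl (modn_small (m := 1)) // => -[].
  by rewrite mulnS addnC modnMDl => /eqP.
case=> mk stE; rewrite stE in sv sd.
apply/val_inj/ffunP => w; apply: val_inj => /=.
have [->|wv] := eqVneq w v; first by rewrite sv labeling_invK.
have [jm wE s0w] := homeK wv.
have {}wE : home (k * m.+1 + (s0 w).-1) = w.
  by rewrite -[RHS]wE; apply: home_mod; rewrite -modnDml (eqP (dvdn_mulr _ mk)).
have := sd _ jm; rewrite wE (displace_root rooted) // => ->.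
by rewrite modnMDl prednK // modn_small.
Qed.

Let round := (\prod_(x <- [seq home j | j <- iota 0 m]) tperm x (par x))%g.

(** [home] has period [m], so every block of [m] toggles acts by the same product. *)
Lemma stone_round q : stone (q * m) = iter q round v.
Proof.
elim: q => // q; rewrite iterS => <-; rewrite mulSn addnC /round big_map.
have H j : stone (q * m + j) =
    (\prod_(i <- iota 0 j) tperm (home i) (par (home i)))%g (stone (q * m)).
  elim: j => [|j IHj]; first by rewrite addn0 big_nil perm1.
  rewrite addnS -(addn1 j) iotaD big_cat big_seq1 permM -IHj /=.
  by rewrite (home_mod (modnMDl _ _ _)).
exact: H.
Qed.

Lemma order_TPro : let t := #|component e v| in
  order (TPro e) s0 = m * (t %/ gcdn t m.+1).
Proof.
move=> t; have t_gt0 : 0 < t by apply/card_gt0P; exists v; rewrite inE.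
have g_gt0 : 0 < gcdn t m.+1 by rewrite gcdn_gt0 t_gt0.
have tE : #|porbit round v| = t.
  apply: (card_porbit_prod e_irr rooted).
    rewrite map_inj_in_uniq ?iota_uniq // => i j; rewrite !mem_iota => im jm.
    exact: (@home_inj 0).
  move=> x; rewrite !inE; apply/mapP/idP => [[j _ ->]|xv].
    exact: home_neq_root.
  have [xm xE _] := homeK xv.
  by exists (s0 x).-1; rewrite ?mem_iota.
apply: order_eq_dvdn => [|k].
  by rewrite muln_gt0 m_gt0 divn_gt0 // dvdn_leq ?dvdn_gcdl.
rewrite iter_TPro_eq; split.
  (* For [k = q * m] the [k * m.+1] toggles make [q * m.+1] rounds, so [t] divides [q * m.+1]; it
     also divides [q * t], hence [q * gcdn t m.+1]. *)
  case=> /dvdnP[q ->]; rewrite mulnAC stone_round => /iter_perm_eq.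
  rewrite tE [q * m]mulnC dvdn_pmul2l // => tq.
  rewrite -(dvdn_pmul2r g_gt0) divnK ?dvdn_gcdl // muln_gcdr.
  by rewrite dvdn_gcd tq dvdn_mull.
move=> N_k; have mk : m %| k by apply: dvdn_trans N_k; apply: dvdn_mulr.
split=> //; case/dvdnP: mk N_k => q ->; rewrite mulnC dvdn_pmul2r // => tq.
rewrite mulnAC stone_round; apply/iter_perm_eq; rewrite tE.
by rewrite -[X in X %| _](divnK (dvdn_gcdl t m.+1)) dvdn_mul ?dvdn_gcdr.
Qed.

End Stone.

Theorem theorem1p3 (V : finType) (n : nat) (e : rel V)
    (cardV : #|V| = n) (n_ge2 : 2 <= n)
    (e_sym : symmetric e) (e_irr : irreflexive e) (e_forest : is_forest e) :
  (forall sigma : labeling V n,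
     let t := #|component e (labeling_inv sigma (Ordinal (ltnW n_ge2)))| in
     order (TPro e) sigma = (n - 1) * (t %/ gcdn t n))
  /\ (is_tree e ->
      forall sigma : labeling V n, order (TPro e) sigma = n - 1).
Proof.
have main : forall sigma : labeling V n,
     let t := #|component e (labeling_inv sigma (Ordinal (ltnW n_ge2)))| in
     order (TPro e) sigma = (n - 1) * (t %/ gcdn t n).
  case: n cardV n_ge2 => // m _ n_ge2 sigma.
  have -> : Ordinal (ltnW n_ge2) = ord0 by apply: val_inj.
  have [par [depth rooted]] :=
    forest_rooted_at e_sym e_irr e_forest (labeling_inv sigma ord0).
  by rewrite subn1; apply: (order_TPro _ e_sym e_irr rooted).
split=> // -[_ _ e_conn] sigma; rewrite main.
have -> : component e (labeling_inv sigma (Ordinal (ltnW n_ge2))) = [set: V].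
  by apply/setP => x; rewrite !inE e_conn.
by rewrite cardsT cardV gcdnn divnn (ltnW n_ge2) muln1.
Qed.
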